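(* The theory $\mathsf{GPK}^+$ implies (every axiom of) $\mathsf{TS}$, and it implies that unions of sets are sets, i.e. that $\bigcup a$ is $\mathbb{T}$-closed for every $a\in\mathbb{V}$.
   Context: Language and class axioms. The language has a binary relation symbol $\in$ and a constant $\mathbb{A}$. $X$ is an atom if $X\in\mathbb{A}$, otherwise $X$ is a class; a class that is an element of some class is a set, any other class is proper. Capital variables range over all objects, lowercase variables only over sets and atoms (objects that are elements of some class). For a formula $\phi$, $\phi^C$ is $\phi$ with all quantifiers restricted to sets and atoms. The class axioms are: Extensionality (classes $X,Y\notin\mathbb{A}$ with the same elements are equal); Atoms ($X\in\mathbb{A}\Rightarrow Y\notin X$); Nontriviality ($\exists x,y\; x\neq y$); weak Comprehension (for every formula $\psi$ of the form $\phi^C$ and all parameters $\vec P$, the class $\{x\mid\psi(x,\vec P)\}$ exists). $\mathbb{V}=\{x\mid x=x\}$; $\mathbb{T}=\{x\mid\exists y\; y\in x\}$ is the class of nonempty sets. A class $A$ is $\mathbb{T}$-closed if $A=\emptyset$ or $A\in\mathbb{T}$. $\square A=\{b\in\mathbb{T}\mid b\subseteq A\}$, $\lozenge A=\{b\in\mathbb{T}\mid b\cap A\neq\emptyset\}$. A set $d$ is discrete if all its nonempty subclasses are sets; $\mathcal{D}$ is the class of all discrete sets. A class $A$ is $\mathcal{D}$-small if $A=\emptyset$ or there is a surjection from a discrete set onto $A$. Ordered pairs are Kuratowski pairs; functions are classes of ordered pairs. $\mathsf{TS}$ (topological set theory) consists of the class axioms and: $\mathbb{V}\in\mathbb{V}$;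 (2nd topology axiom) if $A\subseteq\mathbb{T}$ is nonempty, $\bigcap A$ is $\mathbb{T}$-closed; (3rd topology axiom) if $a,b$ are $\mathbb{T}$-closed, so is $a\cup b$; ($T_1$) $\{a\}$ is $\mathbb{T}$-closed; (Exponential) $\square a\cap\lozenge b$ is $\mathbb{T}$-closed for all sets $a,b$; (Discrete Additivity) $\bigcup A$ is $\mathbb{T}$-closed for every $\mathcal{D}$-small class $A$. Generalized positive formulas (GPF), in variables $X_1,X_2,\dots$ and parameters $Y_1,Y_2,\dots$ (all distinct), are defined recursively: atomic formulas $X_i\in X_j$, $X_i=X_j$ are GPF; if $\phi,\psi$ are GPF, so are $\phi\wedge\psi$ and $\phi\vee\psi$; if $\phi$ is a GPF and $i\neq j$, then $\forall X_i{\in}X_j\,\phi$ and $\exists X_i{\in}X_j\,\phi$ are GPF; if $\phi$ is a GPF, so is $\forall X_i{\in}Y_j\,\phi$. GPF specification is the scheme: for every GPF $\phi(X_1,\dots,X_m,Y_1,\dots,Y_n)$ with parameters $Y_1,\dots,Y_n$ and whose other free variables are among $X_1,\dots,X_m$, for all $c,b_2,\dots,b_m\in\mathbb{V}$ and all classes $B_1,\dots,B_n$, the class $\{x\in c\mid\phi(x,b_2,\dots,b_m,B_1,\dots,B_n)\}$ is $\mathbb{T}$-closed. $\mathsf{GPK}^+$ consists of the class axioms, $\mathbb{V}\in\mathbb{V}$, $\mathbb{A}=\emptyset\in\mathbb{V}$, and GPF specification. *)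

(* Defs.v *)
(** The two theories are presented through their models: a theory implies a
    statement when the statement holds in every structure satisfying its axioms.
    Single axioms are written directly as properties of a structure; the formulas
    over which the two schemes range are syntactic objects. *)

Record structure : Type := Structure {
  univ :> Type;
  mem : univ -> univ -> Prop;
  atoms : univ
}.

Arguments mem {_} _ _.
Arguments atoms {_}.

Declare Scope class_scope.
Notation "x ∈ y" := (mem x y) (at level 70, no associativity) : class_scope.
Notation "x ∉ y" := (~ mem x y) (at level 70, no associativity) : class_scope.
Open Scope class_scope.

(** The same two families of variables serve for all formulas; the distinction
    matters only for generalized positive formulas, where the [Y j] are the
    parameters. *)
Inductive var : Type := X (i : nat) | Y (j : nat).

Definition var_eq_dec (v w : var) : {v = w} + {v <> w}.
Proof. decide equality; decide equality. Defined.

Inductive term : Type := Var (v : var) | Atoms.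

Coercion Var : var >-> term.

Inductive formula : Type :=
| Mem (s t : term)
| Eq (s t : term)
| Neg (phi : formula)
| And (phi psi : formula)
| Or (phi psi : formula)
| Imp (phi psi : formula)
| All (v : var) (phi : formula)
| Ex (v : var) (phi : formula).

Definition update {T : Type} (rho : var -> T) (v : var) (x : T) : var -> T :=
  fun w => if var_eq_dec w v then x else rho w.

Definition eval {M : structure} (rho : var -> M) (t : term) : M :=
  match t with Var v => rho v | Atoms => atoms end.

Fixpoint sat {M : structure} (rho : var -> M) (phi : formula) : Prop :=
  match phi with
  | Mem s t => eval rho s ∈ eval rho t
  | Eq s t => eval rho s = eval rho t
  | Neg phi => ~ sat rho phi
  | And phi psi => sat rho phi /\ sat rho psi
  | Or phi psi => sat rho phi \/ sat rho psi
  | Imp phi psi => sat rho phi -> sat rho psi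
  | All v phi => forall x : M, sat (update rho v x) phi
  | Ex v phi => exists x : M, sat (update rho v x) phi
  end.

Definition swap_var (v : var) : var :=
  match v with X i => Y i | Y j => X j end.

(** The formula "[v] is an element of some class"; the bound variable only has
    to differ from [v]. *)
Definition elem_formula (v : var) : formula :=
  let w := swap_var v in Ex w (And (Neg (Mem w Atoms)) (Mem v w)).

(** φ^C: all quantifiers restricted to sets and atoms. *)
Fixpoint relativize (phi : formula) : formula :=
  match phi with
  | Mem s t => Mem s t
  | Eq s t => Eq s t
  | Neg phi => Neg (relativize phi)
  | And phi psi => And (relativize phi) (relativize psi)
  | Or phi psi => Or (relativize phi) (relativize psi)
  | Imp phi psi => Imp (relativize phi) (relativize psi)
  | All v phi => All v (Imp (elem_formula v) (relativize phi))
  | Ex v phi => Ex v (And (elem_formula v) (relativize phi))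
  end.

Definition AllIn (v w : var) (phi : formula) : formula := All v (Imp (Mem v w) phi).
Definition ExIn (v w : var) (phi : formula) : formula := Ex v (And (Mem v w) phi).

Inductive gpf : formula -> Prop :=
| gpf_mem i j : gpf (Mem (X i) (X j))
| gpf_eq i j : gpf (Eq (X i) (X j))
| gpf_and phi psi : gpf phi -> gpf psi -> gpf (And phi psi)
| gpf_or phi psi : gpf phi -> gpf psi -> gpf (Or phi psi)
| gpf_all i j phi : i <> j -> gpf phi -> gpf (AllIn (X i) (X j) phi)
| gpf_ex i j phi : i <> j -> gpf phi -> gpf (ExIn (X i) (X j) phi)
| gpf_all_param i j phi : gpf phi -> gpf (AllIn (X i) (Y j) phi).

Definition is_atom {M : structure} (x : M) : Prop := x ∈ atoms.
Definition is_class {M : structure} (x : M) : Prop := ~ is_atom x.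

(** Membership in 𝕍: the range of the lowercase variables. *)
Definition in_V {M : structure} (x : M) : Prop := exists c : M, is_class c /\ x ∈ c.

Definition is_set {M : structure} (x : M) : Prop := is_class x /\ in_V x.

Definition nonempty {M : structure} (a : M) : Prop := exists x : M, x ∈ a.

Definition is_empty {M : structure} (a : M) : Prop := is_class a /\ ~ nonempty a.

Definition subclass {M : structure} (a b : M) : Prop := forall x : M, x ∈ a -> x ∈ b.

(** Membership in 𝕋, the class of nonempty sets. *)
Definition in_T {M : structure} (x : M) : Prop := is_set x /\ nonempty x.

Definition T_closed {M : structure} (a : M) : Prop := is_empty a \/ in_T a.

(** [is_comp c P]: [c] is the class {x | P x}, where [x] is a lowercase variable. *)
Definition is_comp {M : structure} (c : M) (P : M -> Prop) : Prop :=
  is_class c /\ forall x : M, x ∈ c <-> in_V x /\ P x.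

(** "The class {x | P x} is 𝕋-closed." *)
Definition comp_T_closed {M : structure} (P : M -> Prop) : Prop :=
  exists c : M, is_comp c P /\ T_closed c.

Definition Singleton {M : structure} (a : M) : M -> Prop := fun x => x = a.
Definition Union {M : structure} (a b : M) : M -> Prop := fun x => x ∈ a \/ x ∈ b.
Definition BigUnion {M : structure} (a : M) : M -> Prop :=
  fun x => exists y : M, y ∈ a /\ x ∈ y.
Definition BigInter {M : structure} (a : M) : M -> Prop :=
  fun x => forall y : M, y ∈ a -> x ∈ y.
Definition Box {M : structure} (a : M) : M -> Prop := fun b => in_T b /\ subclass b a.
Definition Diamond {M : structure} (a : M) : M -> Prop :=
  fun b => in_T b /\ exists x : M, x ∈ b /\ x ∈ a.

Definition discrete {M : structure} (d : M) : Prop :=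
  is_set d /\
  forall b : M, is_class b -> subclass b d -> nonempty b -> is_set b.

Definition is_upair {M : structure} (p x y : M) : Prop :=
  is_class p /\ forall z : M, z ∈ p <-> z = x \/ z = y.

(** [p] is the Kuratowski pair {{x}, {x, y}}. *)
Definition is_opair {M : structure} (p x y : M) : Prop :=
  exists s t : M, is_upair s x x /\ is_upair t x y /\ is_upair p s t.

Definition maps_to {M : structure} (f x y : M) : Prop :=
  exists p : M, is_opair p x y /\ p ∈ f.

Definition surjection {M : structure} (f d a : M) : Prop :=
  is_class f /\
  (forall p : M, p ∈ f -> exists x y : M, is_opair p x y /\ x ∈ d /\ y ∈ a) /\
  (forall x : M, x ∈ d -> exists! y : M, maps_to f x y) /\
  (forall y : M, y ∈ a -> exists x : M, maps_to f x y).

Definition D_small {M : structure} (a : M) : Prop :=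
  is_class a /\
  (is_empty a \/ exists d f : M, discrete d /\ surjection f d a).

Record class_axioms (M : structure) : Prop := {
  extensionality : forall a b : M, is_class a -> is_class b ->
    (forall x : M, x ∈ a <-> x ∈ b) -> a = b;
  atoms_axiom : forall a b : M, a ∈ atoms -> b ∉ a;
  nontriviality : exists x y : M, in_V x /\ in_V y /\ x <> y;
  weak_comprehension : forall (phi : formula) (v : var) (rho : var -> M),
    exists c : M, is_comp c (fun x => sat (update rho v x) (relativize phi))
}.

Definition V_in_V (M : structure) : Prop :=
  exists V : M, is_comp V (fun x => x = x) /\ V ∈ V.

Record TS (M : structure) : Prop := {
  TS_class : class_axioms M;
  TS_V : V_in_V M;
  TS_inter : forall a : M, is_class a -> (forall x : M, x ∈ a -> in_T x) ->
    nonempty a -> comp_T_closed (BigInter a);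
  TS_union : forall a b : M, T_closed a -> T_closed b -> comp_T_closed (Union a b);
  TS_T1 : forall a : M, in_V a -> comp_T_closed (Singleton a);
  TS_exponential : forall a b : M, is_set a -> is_set b ->
    comp_T_closed (fun x => Box a x /\ Diamond b x);
  TS_additivity : forall a : M, D_small a -> comp_T_closed (BigUnion a)
}.

(** The assignment [rho] supplies the parameters; [X 0] is the variable bound by
    the class term.  Only finitely many values of [rho] are relevant to [phi]. *)
Definition GPF_specification (M : structure) : Prop :=
  forall (phi : formula) (rho : var -> M) (c : M),
    gpf phi ->
    in_V c ->
    (forall i : nat, in_V (rho (X i))) ->
    (forall j : nat, is_class (rho (Y j))) ->
    comp_T_closed (fun x => x ∈ c /\ sat (update rho (X 0) x) phi).

Record GPKplus (M : structure) : Prop := {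
  GPK_class : class_axioms M;
  GPK_V : V_in_V M;
  GPK_no_atoms : is_empty (@atoms M);
  GPK_empty : in_V (@atoms M);
  GPK_spec : GPF_specification M
}.

(* Main.v *)
Require Import Defs.
From Stdlib Require Import List Classical.
Import ListNotations.

(** Since there are no atoms and [∅] is a set, a class is 𝕋-closed exactly when
    it belongs to 𝕍; and since [𝕍 ∈ 𝕍], the bounding set of a specification may
    be taken to be 𝕍, so every class defined by a generalized positive formula
    is 𝕋-closed ([GPF_comprehension]).  Intersections, binary unions,
    singletons, [□a ∩ ◊b] and unions of sets are defined by such formulas
    directly.

    The substantial axiom is Discrete Additivity.  Because unions of sets are
    sets, it is enough that the image of a discrete set [d] under a class
    function [f] is a set ([surjective_image_in_V]).  The defining formula
    [∃x ∈ d, (x, y) ∈ f] is not generalized positive: [f] is only a class, and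
    a class parameter may bound universal quantifiers but not existential ones.
    As [f] is a function, one can quantify universally instead:
    [y] is the value of [f] at [x] iff every pair [(u, v) ∈ f] satisfies [x ≠ u]
    or [v = y].  What remains is to express [x ≠ u] positively for [x, u ∈ d],
    and this is where discreteness enters: each [d \ {x}] is a set, so [x ≠ u]
    holds iff every set [e] omitting at most one point of [d] contains [x] or
    [u].  The class of these [e] exists by weak comprehension and serves as a
    second class parameter. *)

(** * Specification without a bounding set *)

(** Values for the variables of a generalized positive formula.  The head of
    [xs] belongs to [X 1], because [X 0] is the variable bound by the class
    term. *)
Definition assign {M : structure} (xs ys : list M) (v : var) : M :=
  match v with
  | X 0 => atoms
  | X (S i) => nth i xs atoms
  | Y j => nth j ys atoms
  end.

Ltac prove_gpf := repeat (constructor; try discriminate).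

Section Models.

Variables (M : structure) (H : GPKplus M).

Lemma all_classes (x : M) : is_class x.
Proof. intros Hx. apply (proj2 (GPK_no_atoms M H)). now exists x. Qed.

Lemma elements_in_V (x a : M) : x ∈ a -> in_V x.
Proof. intros Hx. exists a. split; [apply all_classes | exact Hx]. Qed.

Lemma not_in_atoms (x : M) : x ∉ atoms.
Proof. exact (all_classes x). Qed.

Lemma class_ext (a b : M) : (forall x, x ∈ a <-> x ∈ b) -> a = b.
Proof. apply (extensionality M (GPK_class M H)); apply all_classes. Qed.

Lemma empty_in_V (a : M) : ~ nonempty a -> in_V a.
Proof.
  intros Ha. replace a with (@atoms M); [exact (GPK_empty M H) |].
  apply class_ext. intros x. split; intros Hx.
  - now destruct (not_in_atoms x).
  - destruct Ha. now exists x.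
Qed.

Lemma T_closed_iff_in_V (a : M) : T_closed a <-> in_V a.
Proof.
  split.
  - intros [[_ Ha] | [[_ Ha] _]]; [now apply empty_in_V | exact Ha].
  - intros Ha. destruct (classic (nonempty a)) as [Hn | Hn].
    + right. split; [split; [apply all_classes | exact Ha] | exact Hn].
    + left. split; [apply all_classes | exact Hn].
Qed.

Lemma in_T_iff (a : M) : in_T a <-> in_V a /\ nonempty a.
Proof.
  split.
  - intros [[_ Ha] Hn]. now split.
  - intros [Ha Hn]. split; [split; [apply all_classes | exact Ha] | exact Hn].
Qed.

Lemma comp_T_closed_ext (P Q : M -> Prop) :
  (forall x, in_V x -> (P x <-> Q x)) -> comp_T_closed P -> comp_T_closed Q.
Proof.
  intros HPQ [c [[Hc Hcomp] Hcl]]. exists c. split; [split |]; trivial.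
  intros x. rewrite Hcomp. specialize (HPQ x). tauto.
Qed.

Lemma GPF_comprehension (phi : formula) (xs ys : list M) :
  gpf phi -> Forall in_V xs ->
  comp_T_closed (fun x => sat (update (assign xs ys) (X 0) x) phi).
Proof.
  intros Hphi Hxs. destruct (GPK_V M H) as [V [[_ HV] HVV]].
  apply comp_T_closed_ext with
    (P := fun x => x ∈ V /\ sat (update (assign xs ys) (X 0) x) phi).
  - intros x Hx. rewrite HV. tauto.
  - apply (GPK_spec M H); trivial.
    + now apply elements_in_V with V.
    + intros [| i]; [exact (GPK_empty M H) |]. cbn.
      destruct (nth_in_or_default i xs atoms) as [Hi | ->].
      * now apply (proj1 (Forall_forall in_V xs)).
      * exact (GPK_empty M H).
    + intros j. apply all_classes.
Qed.

Lemma in_V_of_comp_T_closed (a : M) (P : M -> Prop) :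
  (forall x, x ∈ a <-> P x) -> comp_T_closed P -> in_V a.
Proof.
  intros Ha [c [[_ Hc] Hcl]]. replace a with c; [now apply T_closed_iff_in_V |].
  apply class_ext. intros x. rewrite Hc, Ha. split; [tauto |].
  intros Hx. split; [| exact Hx]. apply elements_in_V with a. now apply Ha.
Qed.

Lemma big_union_closed (a : M) : in_V a -> comp_T_closed (BigUnion a).
Proof.
  intros Ha.
  exact (GPF_comprehension (ExIn (X 2) (X 1) (Mem (X 0) (X 2))) [a] []
    ltac:(prove_gpf) ltac:(auto)).
Qed.

(** * Recognizing ordered pairs by positive formulas *)

Lemma opair_first (p u v x : M) : is_opair p u v ->
  (exists s, s ∈ p /\ x ∉ s) <-> x <> u.
Proof.
  intros (s & t & [_ Hs] & [_ Ht] & [_ Hp]). split.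
  - intros (r & Hr & Hx) ->. apply Hx. apply Hp in Hr.
    destruct Hr as [-> | ->]; [apply Hs | apply Ht]; auto.
  - intros Hx. exists s. split; [now apply Hp; left |].
    rewrite Hs. tauto.
Qed.

(** Once the first component is known to be [x], the second is determined by
    [⋃p = {x, v}]. *)
Lemma opair_second (p x v y : M) : is_opair p x v ->
  ((forall s, s ∈ p -> forall r, r ∈ s -> r = x \/ r = y) /\
   exists s, s ∈ p /\ y ∈ s) <-> v = y.
Proof.
  intros (s & t & [_ Hs] & [_ Ht] & [_ Hp]). split.
  - intros [Hall [r [Hr Hy]]].
    assert (Hv : v = x \/ v = y).
    { apply (Hall t); [apply Hp | apply Ht]; auto. }
    assert (Hy' : y = x \/ y = v).
    { apply Hp in Hr. destruct Hr as [-> | ->].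
      - apply Hs in Hy. tauto.
      - now apply Ht. }
    intuition congruence.
  - intros ->. split.
    + intros r Hr z Hz. apply Hp in Hr. destruct Hr as [-> | ->].
      * apply Hs in Hz. tauto.
      * now apply Ht.
    + exists t. split; [apply Hp | apply Ht]; auto.
Qed.

(** * Images of discrete sets *)

Lemma discrete_subclass_in_V (d e : M) :
  discrete d -> subclass e d -> in_V e.
Proof.
  intros [_ Hd] He. destruct (classic (nonempty e)) as [Hn | Hn].
  - exact (proj2 (Hd e (all_classes e) He Hn)).
  - now apply empty_in_V.
Qed.

Lemma discrete_remove (d x : M) : discrete d ->
  exists e, in_V e /\ forall z, z ∈ e <-> z ∈ d /\ z <> x.
Proof.
  intros Hd.
  destruct (weak_comprehension M (GPK_class M H)
    (And (Mem (X 0) (X 1)) (Neg (Eq (X 0) (X 2)))) (X 0) (assign [d; x] []))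
    as [e [_ He]].
  cbn in He.
  assert (He' : forall z, z ∈ e <-> z ∈ d /\ z <> x).
  { intros z. rewrite He. split; [tauto |]. intros Hz.
    split; [now apply elements_in_V with d | exact Hz]. }
  exists e. split; [| exact He'].
  apply discrete_subclass_in_V with d; [exact Hd |].
  intros z Hz. now apply He'.
Qed.

(** Inequality of points of a discrete set becomes positive relative to a class
    parameter [E], the class of all sets that omit at most one point of [d]. *)
Lemma discrete_separation (d : M) : discrete d ->
  exists E : M,
    (forall x u, x ∈ d -> u ∈ d -> x <> u -> forall e, e ∈ E -> x ∈ e \/ u ∈ e) /\
    (forall x, exists e, e ∈ E /\ x ∉ e).
Proof.
  intros Hd.
  destruct (weak_comprehension M (GPK_class M H)
    (All (X 2) (Imp (Mem (X 2) (X 1)) (All (X 3) (Imp (Mem (X 3) (X 1))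
      (Or (Eq (X 2) (X 3)) (Or (Mem (X 2) (X 0)) (Mem (X 3) (X 0))))))))
    (X 0) (assign [d] [])) as [E [_ HE]].
  cbn in HE. exists E. split.
  - intros x u Hx Hu Hxu e He. apply HE in He. destruct He as [_ He].
    destruct (He x (elements_in_V x d Hx) Hx u (elements_in_V u d Hu) Hu);
      tauto.
  - intros x. destruct (discrete_remove d x Hd) as [e [HeV He]].
    exists e. split; [| rewrite He; tauto].
    apply HE. split; [exact HeV |].
    intros y _ Hy z _ Hz. rewrite !He.
    destruct (classic (y = x)), (classic (z = x)); intuition congruence.
Qed.

Lemma surjective_image_in_V (f d a : M) :
  discrete d -> surjection f d a -> in_V a.
Proof.
  intros Hd (_ & Hpairs & Hfun & Hsurj).
  destruct (discrete_separation d Hd) as [E [Hsep Havoid]].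
  (* With X 1 = d, Y 0 = f and Y 1 = E, the formula says of y = X 0:
     ∃x ∈ d ∀p ∈ f ((∃s ∈ p ∀u ∈ s ∀e ∈ E (x ∈ e ∨ u ∈ e))
       ∨ (∀s ∈ p ∀r ∈ s (r = x ∨ r = y) ∧ ∃s ∈ p (y ∈ s))).
     The first disjunct says that p does not start with x, the second that it
     ends in y if it does. *)
  apply (in_V_of_comp_T_closed a _) with (2 := GPF_comprehension
    (ExIn (X 2) (X 1) (AllIn (X 3) (Y 0) (Or
      (ExIn (X 4) (X 3) (AllIn (X 5) (X 4) (AllIn (X 6) (Y 1)
        (Or (Mem (X 2) (X 6)) (Mem (X 5) (X 6))))))
      (And
        (AllIn (X 4) (X 3) (AllIn (X 5) (X 4)
          (Or (Eq (X 5) (X 2)) (Eq (X 5) (X 0)))))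
        (ExIn (X 4) (X 3) (Mem (X 0) (X 4)))))))
    [d] [f; E] ltac:(prove_gpf)
    ltac:(constructor; [exact (proj2 (proj1 Hd)) | constructor])).
  cbn. intros y. split.
  - intros Hy. destruct (Hsurj y Hy) as [x [p [Hp Hpf]]].
    assert (Hx : x ∈ d).
    { destruct (Hpairs p Hpf) as (u & v & Hp' & Hu & _).
      replace x with u; [exact Hu |]. symmetry. apply NNPP. intros Hne.
      now apply (opair_first p u v x Hp'), (opair_first p x y x Hp) in Hne. }
    exists x. split; [exact Hx |]. intros q Hqf.
    destruct (Hpairs q Hqf) as (u & v & Hq & Hu & _).
    destruct (classic (x = u)) as [<- | Hxu].
    + right. apply (opair_second q x v y Hq).
      destruct (Hfun x Hx) as [w [_ Hw]].
      transitivity w; [symmetry |]; apply Hw; [exists q | exists p]; auto.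
    + left. destruct Hq as (s & t & [_ Hs] & _ & [_ Hq]).
      exists s. split; [now apply Hq; left |].
      intros z Hz. replace z with u by (apply Hs in Hz; intuition congruence).
      now apply Hsep.
  - intros [x [Hx Hall]]. destruct (Hfun x Hx) as [w [[p [Hp Hpf]] _]].
    destruct (Hpairs p Hpf) as (u & v & Hp' & _ & Hv).
    assert (Hxu : x = u).
    { apply NNPP. intros Hne.
      now apply (opair_first p u v x Hp'), (opair_first p x w x Hp) in Hne. }
    subst u. destruct (Hall p Hpf) as [[s [Hs Hse]] | Hend].
    + exfalso. apply (opair_first p x v x Hp'); [| reflexivity].
      exists s. split; [exact Hs |]. intros Hxs.
      destruct (Havoid x) as [e [He Hxe]].
      destruct (Hse x Hxs e He); contradiction.
    + apply (opair_second p x v y Hp') in Hend. now subst v.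
Qed.

Lemma D_small_in_V (a : M) : D_small a -> in_V a.
Proof.
  intros [_ [[_ Ha] | (d & f & Hd & Hf)]].
  - now apply empty_in_V.
  - now apply surjective_image_in_V with f d.
Qed.

End Models.

(** * The implication between the theories *)

Theorem proposition14 (M : structure) (H : GPKplus M) :
  TS M /\ (forall a : M, in_V a -> comp_T_closed (BigUnion a)).
Proof.
  split; [| exact (big_union_closed M H)]. constructor.
  - exact (GPK_class M H).
  - exact (GPK_V M H).
  - intros a _ _ _.
    exact (GPF_comprehension M H (AllIn (X 1) (Y 0) (Mem (X 0) (X 1))) [] [a]
      ltac:(prove_gpf) ltac:(auto)).
  - intros a b Ha Hb. apply (T_closed_iff_in_V M H) in Ha, Hb.
    exact (GPF_comprehension M H (Or (Mem (X 0) (X 1)) (Mem (X 0) (X 2)))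
      [a; b] [] ltac:(prove_gpf) ltac:(auto)).
  - intros a Ha.
    exact (GPF_comprehension M H (Eq (X 0) (X 1)) [a] []
      ltac:(prove_gpf) ltac:(auto)).
  - intros a b [_ Ha] [_ Hb].
    (* The second conjunct makes x nonempty, so x ∈ 𝕋 needs no formula. *)
    refine (comp_T_closed_ext M _ _ _ (GPF_comprehension M H
      (And (AllIn (X 3) (X 0) (Mem (X 3) (X 1)))
           (ExIn (X 3) (X 0) (Mem (X 3) (X 2))))
      [a; b] [] ltac:(prove_gpf) ltac:(auto))).
    cbn. unfold Box, Diamond. intros x Hx. rewrite (in_T_iff M H). split.
    + intros [Hsub [z [Hz Hzb]]].
      assert (Hn : nonempty x) by now exists z.
      assert (Hm : exists z, z ∈ x /\ z ∈ b) by now exists z.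
      unfold subclass. tauto.
    + intros [[_ Hsub] [_ Hm]]. now split.
  - intros a Ha. apply (big_union_closed M H), (D_small_in_V M H), Ha.
Qed.
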